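(* Let $\Theta_2=U_\omega\circ\Gamma:\operatorname{Idl}(\mathcal D_T)\to\operatorname{Idl}(\mathcal D_T)$. The closure ordinal of $\Theta_2$ from $\downarrow\mathbf 0$ is exactly $\omega\cdot 2$, and the least fixed point of $\Theta_2$ is $$A_{\omega\cdot2}=\bigcup_{n<\omega}\downarrow\mathbf 0^{(\omega+n)}.$$
   Context: Let $\mathcal D_T$ be the poset of Turing degrees under Turing reducibility $\leq_T$, with least degree $\mathbf 0$, join $\mathbf a\vee\mathbf b=\deg_T(A\oplus B)$ and Turing jump $\mathbf a\mapsto\mathbf a'$. A Turing ideal is a nonempty subset $I\subseteq\mathcal D_T$ that is closed downward under $\leq_T$ and closed under $\vee$; $\operatorname{Idl}(\mathcal D_T)$ is the set of Turing ideals ordered by inclusion. For a degree $\mathbf a$, $\downarrow\mathbf a=\{\mathbf b:\mathbf b\leq_T\mathbf a\}$; for a set $S$ of degrees, $\downarrow S=\{\mathbf b:\exists\mathbf s\in S\ (\mathbf b\leq_T\mathbf s)\}$; and $\langle S\rangle$ is the smallest Turing ideal containing $S$ (for $S$ nonempty). Iterated jumps: as sets, $0^{(0)}=\emptyset$, $0^{(n+1)}=(0^{(n)})'$, $0^{(\omega)}=\bigoplus_{n<\omega}0^{(n)}=\{\langle n,x\rangle:x\in 0^{(n)}\}$, and $0^{(\omega+n+1)}=(0^{(\omega+n)})'$ for $n<\omega$. Write $\mathbf 0^{(\alpha)}=\deg_T(0^{(\alpha)})$. Operators on $\operatorname{Idl}(\mathcal D_T)$: $\Gamma(I)=\downarrow\{\mathbf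 a':\mathbf a\in I\}$. With $A_\omega=\bigcup_{n<\omega}\downarrow\mathbf 0^{(n)}$, put $U_\omega(I)=\langle I\cup\{\mathbf 0^{(\omega)}\}\rangle$ if $A_\omega\subseteq I$, and $U_\omega(I)=I$ otherwise. Iteration of an operator $\Theta$ from $I_0=\downarrow\mathbf 0$: $I_{\alpha+1}=\Theta(I_\alpha)$, and $I_\lambda=\bigcup_{\alpha<\lambda}I_\alpha$ for limit ordinals $\lambda$. The closure ordinal of $\Theta$ from $\downarrow\mathbf 0$ is the least ordinal $\alpha$ with $\Theta(I_\alpha)=I_\alpha$. The least fixed point is the least, under inclusion, Turing ideal $I$ with $\Theta(I)=I$. *)

(* Defs.v *)
From Stdlib Require Cantor.
From mathcomp Require Import all_boot.
From mathcomp Require Import boolp classical_sets.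
From mathcomp Require Import zify.
Set Implicit Arguments.
Unset Strict Implicit.
Unset Printing Implicit Defensive.
Local Open Scope classical_set_scope.
Local Open Scope quotient_scope.

Definition pairn (a b : nat) : nat := Cantor.to_nat (a, b).
Definition unpairn (n : nat) : nat * nat := Cantor.of_nat n.

Lemma pairnK a b : unpairn (pairn a b) = (a, b).
Proof. exact: Cantor.cancel_of_to. Qed.

Lemma unpairnK n : pairn (unpairn n).1 (unpairn n).2 = n.
Proof. by rewrite /pairn /unpairn -surjective_pairing Cantor.cancel_to_of. Qed.

Lemma pairn_inj a b c d : pairn a b = pairn c d -> a = c /\ b = d.
Proof. by move=> /(congr1 unpairn); rewrite !pairnK => -[]. Qed.

(* Programs for the unary functions that are partial recursive in an oracle;
   functions of several arguments take their arguments as one paired number.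
   [Prec f g] is primitive recursion and [Mu f] is unbounded minimisation. *)
Inductive code : Type :=
| Zero | Succ | Fst | Snd | Oracle
| Pair of code & code
| Comp of code & code
| Prec of code & code
| Mu of code.

Definition char_fun (A : set nat) (n : nat) : nat := (n \in A).

(* [eval A c n v] : with oracle A, the program c halts on input n with
   output v. *)
Fixpoint eval (A : set nat) (c : code) (n v : nat) : Prop :=
  match c with
  | Zero => v = 0
  | Succ => v = n.+1
  | Fst => v = (unpairn n).1
  | Snd => v = (unpairn n).2
  | Oracle => v = char_fun A n
  | Pair f g => exists a b, [/\ eval A f n a, eval A g n b & v = pairn a b]
  | Comp f g => exists2 m, eval A g n m & eval A f m v
  | Prec f g =>
      let a := (unpairn n).1 in
      (fix rec (k w : nat) : Prop :=
         match k with
         | 0 => eval A f a w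
         | j.+1 => exists2 u, rec j u & eval A g (pairn a (pairn j u)) w
         end) (unpairn n).2 v
  | Mu f =>
      eval A f (pairn n v) 0 /\
      forall k, k < v -> exists w, eval A f (pairn n k) w.+1
  end.

Fixpoint encode (c : code) : nat :=
  match c with
  | Zero => 0
  | Succ => 1
  | Fst => 2
  | Snd => 3
  | Oracle => 4
  | Pair f g => 4 * pairn (encode f) (encode g) + 5
  | Comp f g => 4 * pairn (encode f) (encode g) + 6
  | Prec f g => 4 * pairn (encode f) (encode g) + 7
  | Mu f => 4 * encode f + 8
  end.

Lemma encode_inj : injective encode.
Proof.
elim=> [|||||f IHf g IHg|f IHf g IHg|f IHf g IHg|f IHf]
       [|||||f' g'|f' g'|f' g'|f'] //= E; try lia.
- have /pairn_inj[/IHf-> /IHg->//] :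
    pairn (encode f) (encode g) = pairn (encode f') (encode g') by lia.
- have /pairn_inj[/IHf-> /IHg->//] :
    pairn (encode f) (encode g) = pairn (encode f') (encode g') by lia.
- have /pairn_inj[/IHf-> /IHg->//] :
    pairn (encode f) (encode g) = pairn (encode f') (encode g') by lia.
- by have /IHf-> : encode f = encode f' by lia.
Qed.

Definition turing_le (A B : set nat) : Prop :=
  exists c : code, forall n, eval B c n (char_fun A n).

Definition set_join (A B : set nat) : set nat :=
  [set m | exists2 n, A n & m = n.*2] `|` [set m | exists2 n, B n & m = n.*2.+1].

Definition set_jump (A : set nat) : set nat :=
  [set e | exists2 c, encode c = e & exists v, eval A c e v].

Fixpoint subst_oracle (d c : code) : code :=
  match c with
  | Oracle => d
  | Pair f g => Pair (subst_oracle d f) (subst_oracle d g)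
  | Comp f g => Comp (subst_oracle d f) (subst_oracle d g)
  | Prec f g => Prec (subst_oracle d f) (subst_oracle d g)
  | Mu f => Mu (subst_oracle d f)
  | _ => c
  end.

Lemma eval_subst_oracle A B d c n v :
  (forall m, eval B d m (char_fun A m)) ->
  eval A c n v -> eval B (subst_oracle d c) n v.
Proof.
move=> dP; elim: c n v => [|||||f IHf g IHg|f IHf g IHg|f IHf g IHg|f IHf] n v //=.
- by move->.
- by move=> [a [b [/IHf fa /IHg gb ->]]]; exists a, b.
- by move=> [m /IHg gm /IHf fv]; exists m.
- elim: (unpairn n).2 v => [|k IHk] v /=; first exact: IHf.
  by move=> [u /IHk ku /IHg gv]; exists u.
- move=> [/IHf f0 lt_v]; split=> // k /lt_v[w /IHf fw].
  by exists w.
Qed.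

Lemma turing_le_refl A : turing_le A A.
Proof. by exists Oracle. Qed.

Lemma turing_le_trans B A C : turing_le A B -> turing_le B C -> turing_le A C.
Proof.
move=> [c cP] [d dP]; exists (subst_oracle d c) => n.
exact: eval_subst_oracle dP (cP n).
Qed.

Definition turing_eqb (A B : set nat) : bool :=
  `[< turing_le A B /\ turing_le B A >].

Lemma turing_eqb_refl : reflexive turing_eqb.
Proof. by move=> A; apply/asboolP; split; exact: turing_le_refl. Qed.

Lemma turing_eqb_sym : symmetric turing_eqb.
Proof. by move=> A B; apply/asboolP/asboolP => -[]. Qed.

Lemma turing_eqb_trans : transitive turing_eqb.
Proof.
move=> B A C /asboolP[AB BA] /asboolP[BC CB]; apply/asboolP.
by split; [exact: turing_le_trans AB BC | exact: turing_le_trans CB BA].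
Qed.

Canonical turing_equiv : equiv_rel (set nat) :=
  EquivRel turing_eqb turing_eqb_refl turing_eqb_sym turing_eqb_trans.

Definition degree : Type := {eq_quot turing_equiv}.

Definition deg (A : set nat) : degree := \pi_degree A.

(* Turing reducibility, join and jump are invariant under Turing equivalence,
   so that the following operations do not depend on the representatives. *)
Definition deg_le : degree -> degree -> Prop := lift_fun2 degree turing_le.
Definition deg_join : degree -> degree -> degree := lift_op2 degree set_join.
Definition deg_jump : degree -> degree := lift_op1 degree set_jump.
Definition deg0 : degree := deg set0.

Lemma degP A B : deg A = deg B <-> turing_le A B /\ turing_le B A.
Proof.
by split=> [/eqmodP/asboolP //|AB]; apply/eqmodP; apply/asboolP.
Qed.

Lemma deg_leE A B : deg_le (deg A) (deg B) <-> turing_le A B.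
Proof.
rewrite /deg_le; unlock.
have /degP[rA Ar] : deg (repr (deg A)) = deg A by exact: reprK.
have /degP[rB Br] : deg (repr (deg B)) = deg B by exact: reprK.
split=> AB.
- exact: turing_le_trans Ar (turing_le_trans AB rB).
- exact: turing_le_trans rA (turing_le_trans AB Br).
Qed.

Definition turing_ideal (I : set degree) : Prop :=
  [/\ I !=set0,
      forall a b, I b -> deg_le a b -> I a
    & forall a b, I a -> I b -> I (deg_join a b)].

Definition down_deg (a : degree) : set degree := [set b | deg_le b a].

Definition down_set (S : set degree) : set degree :=
  [set b | exists2 s, S s & deg_le b s].

(* The smallest Turing ideal containing S: Turing ideals are closed under
   arbitrary intersections, since they all contain deg0. *)
Definition ideal_gen (S : set degree) : set degree :=
  \bigcap_(I in [set I | turing_ideal I /\ S `<=` I]) I.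

Definition zero_jump (n : nat) : set nat := iter n set_jump set0.

Definition zero_jump_omega : set nat :=
  [set m | exists n x, zero_jump n x /\ m = pairn n x].

(* 0^(omega + n) *)
Definition zero_jump_omega_add (n : nat) : set nat :=
  iter n set_jump zero_jump_omega.

Definition A_omega : set degree :=
  \bigcup_(n in [set: nat]) down_deg (deg (zero_jump n)).

Definition A_omega2 : set degree :=
  \bigcup_(n in [set: nat]) down_deg (deg (zero_jump_omega_add n)).

(* Operators are defined on all sets of degrees, and restrict to operators on
   the Turing ideals. *)
Definition Gamma (I : set degree) : set degree := down_set (deg_jump @` I).

Definition U_omega (I : set degree) : set degree :=
  if pselect (A_omega `<=` I) then ideal_gen (I `|` [set deg zero_jump_omega])
  else I.

Definition Theta2 : set degree -> set degree := U_omega \o Gamma.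

(* Ordinals are represented by well-ordered types. *)
Record wo : Type := WO {
  wo_sort :> Type;
  wo_lt : wo_sort -> wo_sort -> Prop;
  wo_lt_trans : forall x y z, wo_lt x y -> wo_lt y z -> wo_lt x z;
  wo_lt_total : forall x y, [\/ wo_lt x y, x = y | wo_lt y x];
  wo_lt_wf : well_founded wo_lt
}.

(* b < a : b is isomorphic to a proper initial segment of a. *)
Definition ord_lt (b a : wo) : Prop :=
  exists (x : a) (f : b -> a),
    (forall y z, wo_lt y z -> wo_lt (f y) (f z)) /\
    (forall y, wo_lt y x <-> exists z, f z = y).

Definition option_lt (T : Type) (lt : T -> T -> Prop) (x y : option T) : Prop :=
  match x, y with
  | Some x, Some y => lt x y
  | Some _, None => True
  | None, _ => False
  end.

(* The successor a + 1, whose largest element is None. *)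
Definition wo_succ (a : wo) : wo.
Proof.
apply: (@WO (option a) (option_lt (@wo_lt a))).
- by move=> [x|] [y|] [z|] //=; exact: wo_lt_trans.
- move=> [x|] [y|] /=; [|by constructor 1|by constructor 3|by constructor 2].
  by case: (wo_lt_total x y) => [|->|];
    [constructor 1|constructor 2|constructor 3].
- have accS x : Acc (option_lt (@wo_lt a)) (Some x).
    elim: (wo_lt_wf x) => {}x _ IH; constructor=> -[y|//]; exact: IH.
  by move=> [x|]; [exact: accS|constructor=> -[y|//] _].
Defined.

Definition lex_lt (S T : Type) (ltS : S -> S -> Prop) (ltT : T -> T -> Prop)
    (x y : S * T) : Prop :=
  ltT x.2 y.2 \/ (x.2 = y.2 /\ ltS x.1 y.1).

(* The ordinal product a * b: b copies of a, one after the other. *)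
Definition wo_mul (a b : wo) : wo.
Proof.
apply: (@WO (a * b) (lex_lt (@wo_lt a) (@wo_lt b))).
- move=> [x i] [y j] [z k] [/= ij|/= [-> xy]] [/= jk|/= [<- yz]].
  + by left; exact: wo_lt_trans ij jk.
  + by left.
  + by left.
  + by right; split=> //; exact: wo_lt_trans xy yz.
- move=> [x i] [y j]; case: (wo_lt_total i j) => [ij|<-|ji].
  + by constructor 1; left.
  + case: (wo_lt_total x y) => [xy|<-|yx].
    * by constructor 1; right.
    * by constructor 2.
    * by constructor 3; right.
  + by constructor 3; left.
- move=> [x i]; elim: (wo_lt_wf i) x => {}i _ IHi x.
  elim: (wo_lt_wf x) => {}x _ IHx; constructor=> -[y j] [/= ji|/= [-> yx]].
  + exact: IHi.
  + exact: IHx.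
Defined.

Definition wo_omega : wo.
Proof.
apply: (@WO nat (fun m n => m < n)).
- by move=> x y z; exact: ltn_trans.
- by move=> x y; case: (ltngtP x y) => [||->];
    [constructor 1|constructor 3|constructor 2].
- by move=> n; elim/ltn_ind: n => n IH; constructor.
Defined.

Definition wo_fin (n : nat) : wo.
Proof.
apply: (@WO 'I_n (fun i j => i < j)).
- by move=> x y z xy yz; exact: ltn_trans xy yz.
- move=> x y; case: (ltngtP x y) => xy; [by constructor 1|by constructor 3|].
  by constructor 2; exact: ord_inj.
- move=> i; have [m] := ubnP (i : nat).
  elim: m i => [i //|m IH i im].
  by constructor=> j ji; apply: IH; exact: leq_trans ji im.
Defined.

Definition omega2 : wo := wo_mul wo_omega (wo_fin 2).

Definition wo_zero (a : wo) (x : a) : Prop := forall y, ~ wo_lt y x.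

Definition wo_is_succ (a : wo) (y x : a) : Prop :=
  wo_lt y x /\ forall z, wo_lt z x -> ~ wo_lt y z.

Definition wo_limit (a : wo) (x : a) : Prop :=
  ~ wo_zero x /\ forall y, ~ wo_is_succ y x.

Section Iteration.
Variables (T : Type) (Theta : set T -> set T) (I0 : set T).

(* The iterate at x, obtained from the iterates at all y < x. *)
Definition stage_step (a : wo) (x : a) (J : forall y, wo_lt y x -> set T) :
    set T :=
  [set d | [\/ wo_zero x /\ I0 d,
               exists (y : a) (yx : wo_is_succ y x), Theta (J y yx.1) d
             | wo_limit x /\ exists (y : a) (yx : wo_lt y x), J y yx d]].

Definition stage (a : wo) : a -> set T :=
  Fix (@wo_lt_wf a) (fun _ => set T) (@stage_step a).

(* I_a : a itself is the order type of the elements below None in a + 1. *)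
Definition iterate (a : wo) : set T := @stage (wo_succ a) None.

Lemma stageE (a : wo) (x : a) : stage x = @stage_step a x (fun y _ => stage y).
Proof.
rewrite /stage Fix_eq// => {}x f g fg; congr stage_step.
by apply/functional_extensionality_dep => y;
  apply/functional_extensionality_dep => yx.
Qed.

Lemma wo_lt_irr (a : wo) (x : a) : ~ wo_lt x x.
Proof. by elim: (wo_lt_wf x) => {}x _ IH xx; exact: (IH x xx xx). Qed.

Lemma stage_zero (a : wo) (x : a) : wo_zero x -> stage x = I0.
Proof.
move=> x0; rewrite stageE; apply/seteqP; split=> d.
- by case=> [[]//|[y [[/x0]]]//|[[]//]].
- by move=> ?; constructor 1.
Qed.

Lemma stage_succ (a : wo) (x y : a) :
  wo_is_succ y x -> stage x = Theta (stage y).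
Proof.
move=> yx; rewrite stageE; apply/seteqP; split=> d.
- case=> [[/(_ _ yx.1)//]|[z [zx]]|[[_ /(_ y)//]]].
  by case: (wo_lt_total y z) => [/(yx.2 _ zx.1)//|->//|/(zx.2 _ yx.1)].
- by move=> ?; constructor 2; exists y, yx.
Qed.

Lemma stage_limit (a : wo) (x : a) :
  wo_limit x -> stage x = \bigcup_(y in [set y | wo_lt y x]) stage y.
Proof.
move=> xlim; rewrite stageE; apply/seteqP; split=> d.
- case=> [[/xlim.1//]|[y [yx]]|[_ [y [yx]]]]; first by have := xlim.2 _ yx.
  by exists y.
- by move=> [y yx Jd]; constructor 3; split=> //; exists y, yx.
Qed.

Definition closure_ordinal (a : wo) : Prop :=
  Theta (iterate a) = iterate a /\
  forall b : wo, ord_lt b a -> Theta (iterate b) <> iterate b.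

End Iteration.

Definition least_fixed_ideal (Theta : set degree -> set degree)
    (I : set degree) : Prop :=
  [/\ turing_ideal I, Theta I = I
    & forall J, turing_ideal J -> Theta J = J -> I `<=` J].

(* Main.v *)
(** Below [omega] the operator only takes jumps, so [I_n] is the principal
    ideal of [0^(n)]; [I_omega = A_omega] is closed under the jump, but there
    [U_omega] fires and adjoins [0^(omega)], so that [I_(omega+n+1)] is the
    principal ideal of [0^(omega+n)]. All these inclusions are strict since
    [A'] is not computable in [A], and the union [A_omega2] is closed under
    both operators. The recursion-theoretic input is the monotonicity of the
    jump: replacing the oracle calls of a program by another program is a
    computable operation on program codes. *)
Require Import Defs.
From Stdlib Require Cantor.
From mathcomp Require Import all_boot.
From mathcomp Require Import boolp classical_sets.
From mathcomp Require Import zify.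
Set Implicit Arguments.
Unset Strict Implicit.
Unset Printing Implicit Defensive.
Local Open Scope classical_set_scope.
Local Open Scope quotient_scope.

(** * Computability relative to an oracle *)

Definition computable_in (B : set nat) (f : nat -> nat) : Prop :=
  exists c, forall n, eval B c n (f n).

Section Computable.
Variable B : set nat.
Implicit Types f g h k : nat -> nat.

Lemma computable_ext f g : f =1 g -> computable_in B f -> computable_in B g.
Proof. by move=> fg [c cP]; exists c => n; rewrite -fg. Qed.

Lemma computable_comp f g :
  computable_in B f -> computable_in B g -> computable_in B (fun n => f (g n)).
Proof. by move=> [c cP] [d dP]; exists (Comp c d) => n; exists (g n). Qed.

Lemma computable_pair f g :
  computable_in B f -> computable_in B g ->
  computable_in B (fun n => pairn (f n) (g n)).
Proof.
by move=> [c cP] [d dP]; exists (Pair c d) => n; exists (f n), (g n).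
Qed.

Lemma computable_fst f :
  computable_in B f -> computable_in B (fun n => (unpairn (f n)).1).
Proof. by move=> [c cP]; exists (Comp Fst c) => n; exists (f n). Qed.

Lemma computable_snd f :
  computable_in B f -> computable_in B (fun n => (unpairn (f n)).2).
Proof. by move=> [c cP]; exists (Comp Snd c) => n; exists (f n). Qed.

Lemma computable_succ f :
  computable_in B f -> computable_in B (fun n => (f n).+1).
Proof. by move=> [c cP]; exists (Comp Succ c) => n; exists (f n). Qed.

Lemma computable_id : computable_in B id.
Proof.
apply: (@computable_ext (fun n => pairn (unpairn n).1 (unpairn n).2)).
  by move=> n; exact: unpairnK.
by apply: computable_pair; [exists Fst | exists Snd].
Qed.

Lemma computable_const m : computable_in B (fun=> m).
Proof. by elim: m => [|m IH]; [exists Zero | exact: computable_succ]. Qed.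

(** The step function receives the parameter [n], the round [j] and the running value [r] as
    [pairn n (pairn j r)], exactly as [Prec] passes them. The arithmetic below reduces to this
    scheme. *)
Lemma computable_iteri k (g : nat -> nat -> nat -> nat) f :
  computable_in B k ->
  computable_in B
    (fun p => g (unpairn p).1 (unpairn (unpairn p).2).1
                (unpairn (unpairn p).2).2) ->
  computable_in B f ->
  computable_in B (fun n => iteri (k n) (g n) (f n)).
Proof.
move=> [ck kP] [cg gP] [cf fP].
(* [Pair Fst Snd] computes the identity, so [Prec] is run on [pairn n (k n)]. *)
exists (Comp (Prec cf cg) (Pair (Pair Fst Snd) ck)) => n /=.
exists (pairn n (k n)).
  exists n, (k n); split=> //.
  by exists (unpairn n).1, (unpairn n).2; split=> //; rewrite unpairnK.
rewrite pairnK /=; elim: (k n) => [|j IH] /=; first exact: fP.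
exists (iteri j (g n) (f n)) => //.
by have := gP (pairn n (pairn j (iteri j (g n) (f n)))); rewrite !pairnK.
Qed.

Lemma computable_add f g :
  computable_in B f -> computable_in B g ->
  computable_in B (fun n => f n + g n).
Proof.
move=> cf cg.
apply: (@computable_ext (fun n => iteri (g n) (fun _ r => r.+1) (f n))).
  by move=> n; elim: (g n) => [|j IH] /=; rewrite ?addn0 // IH addnS.
apply: (@computable_iteri _ (fun _ _ r => r.+1)) => //.
by apply: computable_succ; do 2 apply: computable_snd; exact: computable_id.
Qed.

Lemma computable_pred f :
  computable_in B f -> computable_in B (fun n => (f n).-1).
Proof.
move=> cf.
apply: (@computable_ext (fun n => iteri (f n) (fun j _ => j) 0)).
  by move=> n; case: (f n).
apply: (@computable_iteri _ (fun _ j _ => j)) => //;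
  last exact: computable_const.
by apply: computable_fst; apply: computable_snd; exact: computable_id.
Qed.

Lemma computable_sub f g :
  computable_in B f -> computable_in B g ->
  computable_in B (fun n => f n - g n).
Proof.
move=> cf cg.
apply: (@computable_ext (fun n => iteri (g n) (fun _ r => r.-1) (f n))).
  by move=> n; elim: (g n) => [|j IH] /=; rewrite ?subn0 // IH subnS.
apply: (@computable_iteri _ (fun _ _ r => r.-1)) => //.
by apply: computable_pred; do 2 apply: computable_snd; exact: computable_id.
Qed.

(** Zero rounds of an iteration leave [g n]; any positive number of rounds overwrites it with
    [h n]. *)
Lemma computable_if f g h :
  computable_in B f -> computable_in B g -> computable_in B h ->
  computable_in B (fun n => if f n == 0 then g n else h n).
Proof.
move=> cf cg ch.
apply: (@computable_ext (fun n => iteri (f n) (fun _ _ => h n) (g n))).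
  by move=> n; case: (f n).
apply: (@computable_iteri _ (fun n _ _ => h n)) => //.
by apply: (computable_comp ch); apply: computable_fst; exact: computable_id.
Qed.

Lemma computable_mul4 f :
  computable_in B f -> computable_in B (fun n => 4 * f n).
Proof.
move=> cf; apply: (@computable_ext (fun n => f n + f n + f n + f n)).
  by move=> n; lia.
by do 3 apply: computable_add => //.
Qed.

Lemma computable_mod4 f :
  computable_in B f -> computable_in B (fun n => f n %% 4).
Proof.
(* A counter runs cyclically through 0, 1, 2, 3; with truncated subtraction, [r - 2 == 0] means
   [r <= 2]. *)
move=> cf; apply: (@computable_ext
  (fun n => iteri (f n) (fun _ r => if r - 2 == 0 then r.+1 else 0) 0)).
  by move=> n; elim: (f n) => [|j /= ->] //; case: ifP => /eqP; lia.
apply: (@computable_iteri _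
  (fun _ _ r => if r - 2 == 0 then r.+1 else 0)) => //;
  last exact: computable_const.
have cr : computable_in B (fun p => (unpairn (unpairn p).2).2).
  by do 2 apply: computable_snd; exact: computable_id.
apply: computable_if; [|exact: computable_succ|exact: computable_const].
by apply: computable_sub => //; exact: computable_const.
Qed.

Lemma computable_div4 f :
  computable_in B f -> computable_in B (fun n => f n %/ 4).
Proof.
(* The quotient grows exactly in the rounds [j] with [j %% 4 = 3]. *)
move=> cf; apply: (@computable_ext
  (fun n => iteri (f n) (fun j r => if j %% 4 - 2 == 0 then r else r.+1) 0)).
  by move=> n; elim: (f n) => [|j /= ->] //; case: ifP => /eqP; lia.
apply: (@computable_iteri _
  (fun _ j r => if j %% 4 - 2 == 0 then r else r.+1)) => //;
  last exact: computable_const.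
have cj : computable_in B (fun p => (unpairn (unpairn p).2).1).
  by apply: computable_fst; apply: computable_snd; exact: computable_id.
have cr : computable_in B (fun p => (unpairn (unpairn p).2).2).
  by do 2 apply: computable_snd; exact: computable_id.
apply: computable_if => //; last exact: computable_succ.
by apply: computable_sub; [exact: computable_mod4|exact: computable_const].
Qed.

End Computable.

Lemma many_one_turing_le (A B : set nat) (f : nat -> nat) :
  computable_in B f -> (forall n, A n <-> B (f n)) -> turing_le A B.
Proof.
move=> cf AB; suff : computable_in B (char_fun A) by [].
apply: (@computable_ext _ (fun n => char_fun B (f n))).
  move=> n; rewrite /char_fun; congr nat_of_bool.
  by apply/idP/idP; rewrite !inE => /AB.
by apply: computable_comp cf; exists Oracle.
Qed.

(** * Course-of-values recursion *)

(** Since [h] lists all earlier values, course-of-values recursion becomes plain iteration. *)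
Definition history (F : nat -> nat -> nat) (n : nat) : nat :=
  iteri n (fun j h => pairn (F j h) h) 0.

(* The value at [i < n] stored in a history [h] of length [n], whose most
   recent entry comes first. *)
Definition lookup (h n i : nat) : nat :=
  (unpairn (iteri (n - i.+1) (fun _ r => (unpairn r).2) h)).1.

Lemma lookup_history F n i :
  i < n -> lookup (history F n) n i = F i (history F i).
Proof.
rewrite /lookup => lt_in; have [m ->] : exists m, n = m + i.+1.
  by exists (n - i.+1); rewrite subnK.
rewrite addnK {lt_in n}; set tl := fun _ r => (unpairn r).2.
(* Dropping the [m] newest entries leaves a history whose head is the value at [i]. *)
suff -> : iteri m tl (history F (m + i.+1)) = history F i.+1.
  by rewrite /= pairnK.
(* [iteri] unfolds on the outside, but the newest entry has to be dropped first. *)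
have tlS k h : iteri k.+1 tl h = iteri k tl (tl 0 h).
  by elim: k h => [//|k IH] h /=; rewrite -IH.
elim: m => [//|m IH]; rewrite tlS -IH addSn; congr (iteri _ _ _).
by rewrite /tl /= pairnK.
Qed.

Lemma computable_history B F f :
  computable_in B (fun p => F (unpairn p).1 (unpairn p).2) ->
  computable_in B f -> computable_in B (fun n => history F (f n)).
Proof.
move=> cF cf.
apply: (@computable_iteri B f (fun _ j h => pairn (F j h) h)) => //;
  last exact: computable_const.
have c2 : computable_in B (fun p => (unpairn p).2).
  by apply: computable_snd; exact: computable_id.
by apply: computable_pair (computable_comp cF c2) (computable_snd c2).
Qed.

Lemma computable_lookup B h n i :
  computable_in B h -> computable_in B n -> computable_in B i ->
  computable_in B (fun x => lookup (h x) (n x) (i x)).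
Proof.
move=> ch cn ci; apply: computable_fst.
apply: (@computable_iteri B (fun x => n x - (i x).+1)
  (fun _ _ r => (unpairn r).2) h) => //.
  by apply: computable_sub => //; exact: computable_succ.
by do 3 apply: computable_snd; exact: computable_id.
Qed.

(** * Oracle substitution on program codes *)

Lemma leq_pairnl a b : a <= pairn a b.
Proof. by have := Cantor.to_nat_non_decreasing a b; rewrite /pairn; lia. Qed.

Lemma leq_pairnr a b : b <= pairn a b.
Proof. by have := Cantor.to_nat_non_decreasing a b; rewrite /pairn; lia. Qed.

(** Strong induction on [e = 4 * q + r + 5]: the components of [q], and [q] itself for [Mu], are
    smaller than [e]. Thus every input of a reduction between jumps can be read as a program. *)
Lemma encode_surj e : exists c, encode c = e.
Proof.
elim/ltn_ind: e => e IH; case: (ltnP e 5) => e5.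
  case: e e5 {IH} => [|[|[|[|[|//]]]]] _.
  - by exists Zero.
  - by exists Succ.
  - by exists Fst.
  - by exists Snd.
  - by exists Oracle.
have eE : e = 4 * ((e - 5) %/ 4) + (e - 5) %% 4 + 5 by lia.
move: eE; set q := (e - 5) %/ 4; set r := (e - 5) %% 4 => eE.
have r4 : r < 4 by rewrite ltn_mod.
have qE := unpairnK q; have := leq_pairnl (unpairn q).1 (unpairn q).2.
have := leq_pairnr (unpairn q).1 (unpairn q).2; rewrite qE => le2 le1.
have [|c cE] := IH (unpairn q).1; first by lia.
have [|d dE] := IH (unpairn q).2; first by lia.
have [|b bE] := IH q; first by lia.
case: r r4 eE {IH} => [|[|[|[|//]]]] _ eE.
- by exists (Pair c d); rewrite /= cE dE qE; lia.
- by exists (Comp c d); rewrite /= cE dE qE; lia.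
- by exists (Prec c d); rewrite /= cE dE qE; lia.
- by exists (Mu b); rewrite /= bE; lia.
Qed.

(* [h] is the history of the values at the codes below [e]; codes [e >= 5] are
   of the form [4 * q + 5 + r] with [r < 3], or [4 * q + 8] for [Mu]. *)
Definition subst_step (d e h : nat) : nat :=
  if e - 4 == 0 then (if 4 - e == 0 then d else e) else
  let q := (e - 5) %/ 4 in let r := (e - 5) %% 4 in
  if 3 - r == 0 then 4 * lookup h e q + 8 else
  4 * pairn (lookup h e (unpairn q).1) (lookup h e (unpairn q).2) + (5 + r).

Definition subst_code (d e : nat) : nat :=
  subst_step d e (history (subst_step d) e).

(** The tests in [subst_step] compare truncated differences with 0, which is the form that
    [computable_if] handles. *)
Lemma computable_subst_code B d : computable_in B (subst_code d).
Proof.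
have cs : computable_in B (fun p => subst_step d (unpairn p).1 (unpairn p).2).
  have c1 : computable_in B (fun p => (unpairn p).1) by exists Fst.
  have c2 : computable_in B (fun p => (unpairn p).2) by exists Snd.
  have c5 : computable_in B (fun p => (unpairn p).1 - 5).
    by apply: computable_sub => //; exact: computable_const.
  have cq := computable_div4 c5; have cr := computable_mod4 c5.
  have cK := computable_const B.
  apply: computable_if; first exact: computable_sub.
    by apply: computable_if => //; exact: computable_sub.
  apply: computable_if; first exact: computable_sub.
    apply: computable_add => //; apply: computable_mul4.
    exact: computable_lookup.
  apply: computable_add; last exact: computable_add.
  apply: computable_mul4.
  apply: computable_pair; apply: computable_lookup => //.
    exact: computable_fst.
  exact: computable_snd.
apply: (@computable_ext _
  (fun e => let p := pairn e (history (subst_step d) e) in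
            subst_step d (unpairn p).1 (unpairn p).2)).
  by move=> e; rewrite /= pairnK.
apply: (computable_comp cs); apply: computable_pair; first exact: computable_id.
by apply: computable_history => //; exact: computable_id.
Qed.

(** [Pair], [Comp] and [Prec] differ only in [r]. Both sub-codes lie below [e], so the history
    already contains their values. *)
Lemma subst_code_pair d a b r : r < 3 ->
  subst_code d (4 * pairn a b + (5 + r)) =
    4 * pairn (subst_code d a) (subst_code d b) + (5 + r).
Proof.
move=> r3; set e := 4 * _ + _.
have ea := leq_pairnl a b; have eb := leq_pairnr a b.
rewrite {1}/subst_code /subst_step.
have -> : (e - 4 == 0) = false by apply/eqP; lia.
have -> : (e - 5) %/ 4 = pairn a b by lia.
have -> : (e - 5) %% 4 = r by lia.
have -> : (3 - r == 0) = false by apply/eqP; lia.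
have [lt_ae lt_be] : a < e /\ b < e by lia.
rewrite pairnK (lookup_history _ lt_ae) (lookup_history _ lt_be).
by rewrite -!/(subst_code _ _).
Qed.

Lemma subst_code_mu d a : subst_code d (4 * a + 8) = 4 * subst_code d a + 8.
Proof.
set e := 4 * a + 8; rewrite {1}/subst_code /subst_step.
have -> : (e - 4 == 0) = false by apply/eqP; lia.
have -> : (e - 5) %/ 4 = a by lia.
have -> : (e - 5) %% 4 = 3 by lia.
have lt_ae : a < e by lia.
by rewrite (lookup_history _ lt_ae) -/(subst_code _ _).
Qed.

Lemma subst_codeE d c :
  subst_code (encode d) (encode c) = encode (subst_oracle d c).
Proof.
elim: c => [|||||f IHf g IHg|f IHf g IHg|f IHf g IHg|f IHf] //=.
- by rewrite (@subst_code_pair _ _ _ 0) // IHf IHg.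
- by rewrite (@subst_code_pair _ _ _ 1) // IHf IHg.
- by rewrite (@subst_code_pair _ _ _ 2) // IHf IHg.
- by rewrite subst_code_mu IHf.
Qed.

Lemma eval_det A c n v w : eval A c n v -> eval A c n w -> v = w.
Proof.
elim: c n v w => [|||||f IHf g IHg|f IHf g IHg|f IHf g IHg|f IHf] n v w //=;
  try by move=> -> ->.
- by move=> [a [b [/IHf fa /IHg gb ->]]] [a' [b' [/fa<- /gb<- ->]]].
- by move=> [m /IHg gm /IHf fv] [m' /gm<- /fv].
- elim: (unpairn n).2 v w => [|k IHk] v w /=; first exact: IHf.
  by move=> [u /IHk ku /IHg gv] [u' /ku<- /gv].
(* If one search stopped earlier than the other, the body would be both zero and positive at that
   point. *)
- move=> [fv lt_v] [fw lt_w]; case: (ltngtP v w) => // [/lt_w|/lt_v] [x fx].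
    by have := IHf _ _ _ fv fx.
  by have := IHf _ _ _ fw fx.
Qed.

(** The jump asks about halting, so substitution must not make a diverging program halt either.
    Determinism settles the oracle calls. *)
Lemma eval_subst_oracle_inv A B d c n v :
  (forall m, eval B d m (char_fun A m)) ->
  eval B (subst_oracle d c) n v -> eval A c n v.
Proof.
move=> dP.
elim: c n v => [|||||f IHf g IHg|f IHf g IHg|f IHf g IHg|f IHf] n v //=.
- by move=> dv; exact: eval_det dv (dP n).
- by move=> [a [b [/IHf fa /IHg gb ->]]]; exists a, b.
- by move=> [m /IHg gm /IHf fv]; exists m.
- elim: (unpairn n).2 v => [|k IHk] v /=; first exact: IHf.
  by move=> [u /IHk ku /IHg gv]; exists u.
- move=> [/IHf f0 lt_v]; split=> // k /lt_v[w /IHf fw].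
  by exists w.
Qed.

(** * The Turing jump *)

Definition const_code (m : nat) : code := iter m (Comp Succ) Zero.

Lemma eval_const_code A m n v : eval A (const_code m) n v <-> v = m.
Proof.
elim: m n v => [|m IH] n v //=; split=> [[k /IH-> //]|->].
by exists m => //; apply/IH.
Qed.

Lemma computable_encode_const B :
  computable_in B (fun m => encode (const_code m)).
Proof.
(* Here 0 and 1 are the codes of [Zero] and [Succ], and [4 * pairn _ _ + 6] is the code of a
   [Comp]. *)
apply: (@computable_ext _
  (fun m => iteri m (fun _ r => 4 * pairn 1 r + 6) 0)).
  by elim=> [//|m /= ->].
apply: (@computable_iteri _ id (fun _ _ r => 4 * pairn 1 r + 6));
  [exact: computable_id| |exact: computable_const].
apply: computable_add; last exact: computable_const.
apply: computable_mul4; apply: computable_pair; first exact: computable_const.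
by do 2 apply: computable_snd; exact: computable_id.
Qed.

(* The program fed to the jump ignores its own input and runs [c] on [m]. *)
Lemma set_jump_comp_const A c m :
  set_jump A (encode (Comp c (const_code m))) <-> exists v, eval A c m v.
Proof.
split=> [[b /encode_inj-> [v [k /eval_const_code->]]]|[v cv]].
  by exists v.
exists (Comp c (const_code m)) => //; exists v; exists m => //.
exact/eval_const_code.
Qed.

(** An instance of the s-m-n theorem: the input [m] is hard-wired into the program with code
    [f m]. *)
Lemma computable_encode_comp_const B f :
  computable_in B f ->
  computable_in B (fun m => 4 * pairn (f m) (encode (const_code m)) + 6).
Proof.
move=> cf; apply: computable_add; last exact: computable_const.
apply: computable_mul4; apply: computable_pair => //.
exact: computable_encode_const.
Qed.

Lemma set_jump_mono A B : turing_le A B -> turing_le (set_jump A) (set_jump B).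
Proof.
move=> [d dP].
(* The substituted program has a new code but must still run on the old one, so the old code is
   hard-wired as its input. *)
pose f m := 4 * pairn (subst_code (encode d) m) (encode (const_code m)) + 6.
apply: (@many_one_turing_le _ _ f).
  by apply: computable_encode_comp_const; exact: computable_subst_code.
move=> e; have [c <-] := encode_surj e.
have -> : f (encode c) =
    encode (Comp (subst_oracle d c) (const_code (encode c))).
  by rewrite /f subst_codeE.
split=> [[b /encode_inj-> [v cv]]|/set_jump_comp_const[v cv]].
  by apply/set_jump_comp_const; exists v; exact: eval_subst_oracle cv.
by exists c => //; exists v; exact: eval_subst_oracle_inv cv.
Qed.

(* [n] is in [A] iff the search for a zero of the constant [1 - char_fun A n]
   terminates. *)
Lemma turing_le_jump A : turing_le A (set_jump A).
Proof.
have [c cP] : computable_in A (fun p => 1 - char_fun A (unpairn p).1).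
  apply: computable_sub; first exact: computable_const.
  by apply: (@computable_comp _ (char_fun A)); [exists Oracle|exists Fst].
apply: (@many_one_turing_le _ _ (fun m => encode (Comp (Mu c) (const_code m)))).
  by apply: computable_encode_comp_const; exact: computable_const.
move=> n; rewrite set_jump_comp_const; split=> [An|[v [cv _]]].
  exists 0; split=> //; have := cP (pairn n 0).
  by rewrite pairnK /= /char_fun mem_set.
have := eval_det (cP _) cv; rewrite pairnK /= /char_fun.
by case: (boolP (n \in A)); rewrite ?inE.
Qed.

(** Diagonalisation: if [c] decided the jump, [Mu (Comp c Fst)] would halt on [n] exactly when [n]
    is outside the jump, which fails at its own code. *)
Lemma jump_not_turing_le A : ~ turing_le (set_jump A) A.
Proof.
move=> [c cP].
have cE n k v :
    eval A (Comp c Fst) (pairn n k) v <-> v = char_fun (set_jump A) n.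
  rewrite /= pairnK; split=> [[m -> cv]|->]; first exact: eval_det cv (cP n).
  by exists n.
set e := encode (Mu (Comp c Fst)).
have [Ae|nAe] := pselect (set_jump A e).
  have [b /encode_inj-> [v [/cE]]] := Ae.
  by rewrite /char_fun mem_set.
apply: (nAe); exists (Mu (Comp c Fst)) => //; exists 0; split=> //.
by apply/cE; rewrite /char_fun memNset.
Qed.

Lemma turing_le_set0 A : turing_le set0 A.
Proof. by exists Zero => n; rewrite /= /char_fun memNset. Qed.

(** * Joins *)

Lemma turing_le_joinl A B : turing_le A (set_join A B).
Proof.
apply: (@many_one_turing_le _ _ (fun n => n + n)).
  by apply: computable_add; exact: computable_id.
move=> n; rewrite addnn; split=> [An|]; first by left; exists n.
by case=> -[m Xm nm]; [have <- : m = n by lia|lia].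
Qed.

Lemma turing_le_joinr A B : turing_le B (set_join A B).
Proof.
apply: (@many_one_turing_le _ _ (fun n => (n + n).+1)).
  by apply: computable_succ; apply: computable_add; exact: computable_id.
move=> n; rewrite addnn; split=> [An|]; first by right; exists n.
by case=> -[m Xm nm]; [lia|have <- : m = n by lia].
Qed.

(* The half of [n] and its parity are read off [n + n] divided by [4]. *)
Lemma turing_le_join A B C :
  turing_le A C -> turing_le B C -> turing_le (set_join A B) C.
Proof.
move=> AC BC; suff : computable_in C (char_fun (set_join A B)) by [].
have c2 : computable_in C (fun n => n + n).
  by apply: computable_add; exact: computable_id.
apply: (@computable_ext _ (fun n => if (n + n) %% 4 == 0
  then char_fun A ((n + n) %/ 4) else char_fun B ((n + n) %/ 4))); last first.
  by apply: computable_if; [exact: computable_mod4|..];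
    apply: computable_comp => //; exact: computable_div4.
move=> n; rewrite /char_fun; case: eqP => n4; congr nat_of_bool;
  apply/idP/idP; rewrite !inE.
- by move=> An; left; exists ((n + n) %/ 4) => //; lia.
- by case=> -[m Xm nm]; [have -> : (n + n) %/ 4 = m by lia|lia].
- by move=> Bn; right; exists ((n + n) %/ 4) => //; lia.
- by case=> -[m Xm nm]; [lia|have -> : (n + n) %/ 4 = m by lia].
Qed.

(** * Degrees and ideals *)

Lemma deg_surj (d : degree) : exists A, d = deg A.
Proof. by exists (repr d); rewrite /deg reprK. Qed.

Lemma repr_deg A : turing_le A (repr (deg A)) /\ turing_le (repr (deg A)) A.
Proof. by apply/degP; rewrite {2}/deg reprK. Qed.

Lemma deg_le_refl a : deg_le a a.
Proof. by have [A ->] := deg_surj a; apply/deg_leE; exact: turing_le_refl. Qed.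

Lemma deg_le_trans b a c : deg_le a b -> deg_le b c -> deg_le a c.
Proof.
have [[[A ->] [B ->]] [C ->]] := (deg_surj a, deg_surj b, deg_surj c).
by move=> /deg_leE AB /deg_leE BC; apply/deg_leE; exact: turing_le_trans BC.
Qed.

Lemma deg0_le a : deg_le deg0 a.
Proof. by have [A ->] := deg_surj a; apply/deg_leE; exact: turing_le_set0. Qed.

(** The lifted jump acts on a chosen representative; monotonicity makes the choice immaterial. *)
Lemma deg_jumpE A : deg_jump (deg A) = deg (set_jump A).
Proof.
rewrite /deg_jump; unlock; apply/degP.
by have [Ar rA] := repr_deg A; split; exact: set_jump_mono.
Qed.

Lemma deg_le_jump a : deg_le a (deg_jump a).
Proof.
have [A ->] := deg_surj a; rewrite deg_jumpE; apply/deg_leE.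
exact: turing_le_jump.
Qed.

Lemma deg_jump_mono a b : deg_le a b -> deg_le (deg_jump a) (deg_jump b).
Proof.
have [[A ->] [B ->]] := (deg_surj a, deg_surj b); rewrite !deg_jumpE.
by move=> /deg_leE AB; apply/deg_leE; exact: set_jump_mono.
Qed.

Lemma deg_joinE A B : deg_join (deg A) (deg B) = deg (set_join A B).
Proof.
rewrite /deg_join; unlock; apply/degP.
have [[Ar rA] [Br rB]] := (repr_deg A, repr_deg B).
split; apply: turing_le_join.
- exact: turing_le_trans rA (turing_le_joinl _ _).
- exact: turing_le_trans rB (turing_le_joinr _ _).
- exact: turing_le_trans Ar (turing_le_joinl _ _).
- exact: turing_le_trans Br (turing_le_joinr _ _).
Qed.

Lemma deg_join_lub a b c :
  deg_le (deg_join a b) c <-> deg_le a c /\ deg_le b c.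
Proof.
have [[[A ->] [B ->]] [C ->]] := (deg_surj a, deg_surj b, deg_surj c).
rewrite deg_joinE !deg_leE; split=> [abc|[]]; last exact: turing_le_join.
split; [exact: turing_le_trans (turing_le_joinl A B) abc|].
exact: turing_le_trans (turing_le_joinr A B) abc.
Qed.

Lemma turing_ideal_deg0 I : turing_ideal I -> I deg0.
Proof. by move=> [[a Ia] Idown _]; apply: Idown Ia _; exact: deg0_le. Qed.

Lemma turing_ideal_down_sub I a : turing_ideal I -> I a -> down_deg a `<=` I.
Proof. by move=> [_ Idown _] Ia b /= ba; exact: Idown Ia ba. Qed.

Lemma turing_ideal_down a : turing_ideal (down_deg a).
Proof.
split; first by exists a; exact: deg_le_refl.
- by move=> b c /= ca bc; exact: deg_le_trans bc ca.
- by move=> b c ba ca; apply/deg_join_lub.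
Qed.

Lemma turing_ideal_gen S : turing_ideal (ideal_gen S).
Proof.
split.
- by exists deg0 => I [Iid _]; exact: turing_ideal_deg0.
- move=> a b Sb ab I IS; have [[_ Idown _] _] := IS.
  exact: Idown (Sb I IS) ab.
- move=> a b Sa Sb I IS; have [[_ _ Ijoin] _] := IS.
  by apply: Ijoin; [exact: Sa | exact: Sb].
Qed.

Lemma sub_ideal_gen S : S `<=` ideal_gen S.
Proof. by move=> a Sa I [_]; exact. Qed.

Lemma ideal_gen_eq S I : turing_ideal I -> S `<=` I -> I `<=` ideal_gen S ->
  ideal_gen S = I.
Proof.
by move=> Iid SI IS; apply/seteqP; split=> // a; apply; split.
Qed.

(** Closure under joins holds because the jump of a join bounds the jumps of both parts. *)
Lemma turing_ideal_Gamma I : turing_ideal I -> turing_ideal (Gamma I).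
Proof.
move=> [[a Ia] Idown Ijoin]; split.
- by exists (deg_jump a), (deg_jump a); [exists a | exact: deg_le_refl].
- move=> b c [s Is cs] bc; exists s => //; exact: deg_le_trans bc cs.
- move=> b c [_ [b' Ib <-] bb'] [_ [c' Ic <-] cc'].
  exists (deg_jump (deg_join b' c')).
    by exists (deg_join b' c') => //; exact: Ijoin.
  have [bj cj] := (deg_join_lub b' c' (deg_join b' c')).1 (deg_le_refl _).
  apply/deg_join_lub; split;
    [apply: deg_le_trans bb' _|apply: deg_le_trans cc' _];
    exact: deg_jump_mono.
Qed.

Lemma turing_ideal_U_omega I : turing_ideal I -> turing_ideal (U_omega I).
Proof.
rewrite /U_omega; case: pselect => //= _ _; exact: turing_ideal_gen.
Qed.

Lemma turing_ideal_Theta2 I : turing_ideal I -> turing_ideal (Theta2 I).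
Proof. by move=> /turing_ideal_Gamma/turing_ideal_U_omega. Qed.

Lemma sub_Gamma I : I `<=` Gamma I.
Proof.
by move=> a Ia; exists (deg_jump a); [exists a | exact: deg_le_jump].
Qed.

Lemma sub_U_omega I : I `<=` U_omega I.
Proof.
rewrite /U_omega; case: pselect => /= _ a Ia //.
by apply: sub_ideal_gen; left.
Qed.

Lemma Gamma_down A : Gamma (down_deg (deg A)) = down_deg (deg (set_jump A)).
Proof.
rewrite -deg_jumpE; apply/seteqP; split=> [b [_ [a aA <-] ba]|b bA].
  by apply: (deg_le_trans ba); exact: deg_jump_mono.
by exists (deg_jump (deg A)) => //; exists (deg A) => //; exact: deg_le_refl.
Qed.

(** * Iterated jumps *)

(** The common form of [A_omega] and [A_omega2], which start from the empty set and from
    [zero_jump_omega]. *)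
Definition jumps_ideal (A : set nat) : set degree :=
  \bigcup_(n in [set: nat]) down_deg (deg (iter n set_jump A)).

Lemma A_omegaE : A_omega = jumps_ideal set0. Proof. by []. Qed.

Lemma A_omega2E : A_omega2 = jumps_ideal zero_jump_omega. Proof. by []. Qed.

Lemma turing_le_iter_jump A m n :
  m <= n -> turing_le (iter m set_jump A) (iter n set_jump A).
Proof.
elim: n => [|n IH]; first by rewrite leqn0 => /eqP->; exact: turing_le_refl.
rewrite leq_eqVlt ltnS => /orP[/eqP->|/IH le_mn]; first exact: turing_le_refl.
exact: turing_le_trans le_mn (turing_le_jump _).
Qed.

Lemma turing_ideal_jumps A : turing_ideal (jumps_ideal A).
Proof.
split.
- by exists (deg A), 0 => //; exact: deg_le_refl.
- by move=> a b [n _ bn] ab; exists n => //; exact: deg_le_trans ab bn.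
- move=> a b [m _ am] [n _ bn]; exists (maxn m n) => //.
  by apply/deg_join_lub; split;
    [apply: deg_le_trans am _|apply: deg_le_trans bn _];
    apply/deg_leE; apply: turing_le_iter_jump; lia.
Qed.

Lemma Gamma_jumps A : Gamma (jumps_ideal A) = jumps_ideal A.
Proof.
apply/seteqP; split; last exact: sub_Gamma.
move=> b [_ [a [n _ an] <-] ba]; exists n.+1 => //.
by apply: (deg_le_trans ba); rewrite /= -deg_jumpE; exact: deg_jump_mono.
Qed.

Lemma jumps_ideal_min A I : turing_ideal I -> Gamma I `<=` I -> I (deg A) ->
  jumps_ideal A `<=` I.
Proof.
move=> Iid GI IA; suff In n : I (deg (iter n set_jump A)).
  by move=> a [n _]; exact: turing_ideal_down_sub.
elim: n => [//|n IH] /=; rewrite -deg_jumpE; apply: GI.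
by exists (deg_jump (deg (iter n set_jump A)));
  [exists (deg (iter n set_jump A))|exact: deg_le_refl].
Qed.

(** The next iterated jump lies in the ideal but not below the proposed bound. *)
Lemma jumps_ideal_unbounded A n :
  ~ jumps_ideal A `<=` down_deg (deg (iter n set_jump A)).
Proof.
move=> /(_ (deg (iter n.+1 set_jump A))) Hn; apply: (@jump_not_turing_le).
by apply/deg_leE/Hn; exists n.+1 => //; exact: deg_le_refl.
Qed.

Lemma zero_jump_le_omega n : turing_le (zero_jump n) zero_jump_omega.
Proof.
apply: (@many_one_turing_le _ _ (pairn n)).
  by apply: computable_pair; [exact: computable_const|exact: computable_id].
move=> x; split=> [nx|[m [y [my /pairn_inj[-> ->]]]]]; last by [].
by exists n, x.
Qed.

Lemma A_omega_sub_down n : A_omega `<=` down_deg (deg (zero_jump_omega_add n)).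
Proof.
move=> a [m _ am]; apply: (deg_le_trans am); apply/deg_leE.
apply: turing_le_trans (zero_jump_le_omega m) _.
exact: (@turing_le_iter_jump zero_jump_omega 0 n).
Qed.

Lemma A_omega_sub_A_omega2 : A_omega `<=` A_omega2.
Proof. by move=> a /(@A_omega_sub_down 0); exists 0. Qed.

(** * Values of [Theta2] and its least fixed point *)

Lemma U_omega_id I : turing_ideal I -> I (deg zero_jump_omega) -> U_omega I = I.
Proof.
move=> Iid Iw; rewrite /U_omega; case: pselect => //= _.
apply: ideal_gen_eq => //; first by move=> a [//|->].
by move=> a Ia; apply: sub_ideal_gen; left.
Qed.

(** [U_omega] does not fire, since no finite jump bounds [A_omega]. *)
Lemma Theta2_zero_jump n :
  Theta2 (down_deg (deg (zero_jump n))) = down_deg (deg (zero_jump n.+1)).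
Proof.
rewrite /Theta2 /= Gamma_down /U_omega; case: pselect => //=.
by move=> /(@jumps_ideal_unbounded _ n.+1).
Qed.

(** [Gamma] fixes [A_omega] and [U_omega] fires; the adjoined degree bounds all of [A_omega], so the
    generated ideal is principal. *)
Lemma Theta2_A_omega : Theta2 A_omega = down_deg (deg zero_jump_omega).
Proof.
rewrite /Theta2 /= A_omegaE Gamma_jumps /U_omega.
case: pselect => [/= _|[]]; last exact: subset_refl.
apply: ideal_gen_eq; first exact: turing_ideal_down.
- move=> a [/(@A_omega_sub_down 0)//|->]; exact: deg_le_refl.
- apply: turing_ideal_down_sub; first exact: turing_ideal_gen.
  by apply: sub_ideal_gen; right.
Qed.

Lemma Theta2_zero_jump_omega_add n :
  Theta2 (down_deg (deg (zero_jump_omega_add n))) =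
  down_deg (deg (zero_jump_omega_add n.+1)).
Proof.
rewrite /Theta2 /= Gamma_down; apply: U_omega_id.
  exact: turing_ideal_down.
by apply/deg_leE; exact: (@turing_le_iter_jump zero_jump_omega 0 n.+1).
Qed.

Lemma Theta2_A_omega2 : Theta2 A_omega2 = A_omega2.
Proof.
rewrite /Theta2 /= A_omega2E Gamma_jumps; apply: U_omega_id.
  exact: turing_ideal_jumps.
by exists 0 => //; exact: deg_le_refl.
Qed.

(** A fixed ideal [J] is closed under the jump, hence contains [A_omega]; then [U_omega] puts the
    degree of [zero_jump_omega] into [J], and all its iterated jumps follow. *)
Lemma least_fixed_A_omega2 : least_fixed_ideal Theta2 A_omega2.
Proof.
split; [exact: turing_ideal_jumps|exact: Theta2_A_omega2|move=> J Jid JE].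
have GJ : Gamma J `<=` J by rewrite -{2}JE; exact: sub_U_omega.
have AJ : A_omega `<=` J.
  by apply: jumps_ideal_min => //; exact: turing_ideal_deg0.
apply: jumps_ideal_min => //.
(* The branch where [U_omega] does not fire is excluded by [A_omega] lying in [J], hence in
   [Gamma J]. *)
rewrite -JE /Theta2 /= /U_omega; case: pselect => [/= _|[]].
  by apply: sub_ideal_gen; right.
by move=> a /AJ; exact: sub_Gamma.
Qed.

(** * Stages along initial segments *)

Section InitialSegment.
Variables (T : Type) (Theta : set T -> set T) (I0 : set T).
Variables (a b : wo) (f : a -> b).
Hypothesis f_mono : forall x y, wo_lt x y -> wo_lt (f x) (f y).
Hypothesis f_initial : forall x z, wo_lt z (f x) -> exists y, f y = z.

Let f_mono_inv x y : wo_lt (f x) (f y) -> wo_lt x y.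
Proof.
case: (wo_lt_total x y) => [//|->|/f_mono yx xy].
  by move/(@wo_lt_irr b).
by have /(@wo_lt_irr b) := wo_lt_trans xy yx.
Qed.

Lemma wo_zero_initial x : wo_zero (f x) <-> wo_zero x.
Proof.
split=> x0 y => [/f_mono/x0//|yx].
by have [z zE] := f_initial yx; apply: (x0 z); apply: f_mono_inv; rewrite zE.
Qed.

Lemma wo_is_succ_initial y x : wo_is_succ (f y) (f x) <-> wo_is_succ y x.
Proof.
split=> -[yx xmin]; split; first exact: f_mono_inv.
- by move=> z /f_mono/xmin zx /f_mono.
- exact: f_mono.
- move=> z zx; have [w wE] := f_initial zx; rewrite -wE => /f_mono_inv.
  by apply: xmin; apply: f_mono_inv; rewrite wE.
Qed.

Lemma wo_limit_initial x : wo_limit (f x) <-> wo_limit x.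
Proof.
rewrite /wo_limit wo_zero_initial; split=> -[x0 xS]; split=> // y.
  by move=> /wo_is_succ_initial; exact: xS.
move=> yx; have [z zE] := f_initial yx.1; move: yx; rewrite -zE.
by move=> /wo_is_succ_initial; exact: xS.
Qed.

(** A stage depends only on the order below its index, and embeddings onto initial segments preserve
    and reflect zero, successor and limit positions. *)
Lemma stage_initial x : stage Theta I0 (f x) = stage Theta I0 x.
Proof.
elim: (wo_lt_wf x) => {}x _ IH; rewrite !stageE; apply/seteqP; split=> d.
- case=> [[/wo_zero_initial x0 dI]|[z [zx]]|[/wo_limit_initial xl [z [zx]]]].
  + by constructor 1.
  (* Eliminating [yE] replaces [z] by [f y] inside the order proof on which the stage depends. *)
  + have [y yE] := f_initial zx.1; case: _ / yE zx => zx.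
    have yx := (wo_is_succ_initial _ _).1 zx; rewrite (IH _ yx.1) => dy.
    by constructor 2; exists y, yx.
  + have [y yE] := f_initial zx; case: _ / yE zx => zx.
    have yx := f_mono_inv zx; rewrite (IH _ yx) => dy.
    by constructor 3; split=> //; exists y, yx.
- case=> [[/wo_zero_initial x0 dI]|[y [yx]]|[/wo_limit_initial xl [y [yx]]]].
  + by constructor 1.
  + rewrite -(IH _ yx.1) => dy; constructor 2.
    by exists (f y), ((wo_is_succ_initial _ _).2 yx).
  + rewrite -(IH _ yx) => dy; constructor 3; split=> //.
    by exists (f y), (f_mono yx).
Qed.

End InitialSegment.

Lemma stage_Some T (Theta : set T -> set T) I0 (a : wo) (x : a) :
  stage Theta I0 (Some x : wo_succ a) = stage Theta I0 x.
Proof.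
apply: (@stage_initial _ _ _ a (wo_succ a) Some) => // y [z|//] _.
by exists z.
Qed.

(** This reduces minimality of a closure ordinal, a claim about all smaller well-orders, to a claim
    about the elements of [a]. *)
Lemma iterate_initial T (Theta : set T -> set T) I0 (a b : wo) :
  ord_lt b a -> exists x : a, iterate Theta I0 b = stage Theta I0 x.
Proof.
move=> [x [f [f_mono f_init]]]; exists x.
(* The added top element goes to [x], the endpoint of the segment that [f] fills. *)
pose g (y : wo_succ b) : a := if y is Some z then f z else x.
symmetry; apply: (@stage_initial _ _ _ (wo_succ b) a g _ _ None).
- move=> [y|] [z|] //=; first exact: f_mono.
  by move=> _; apply/f_init; exists y.
- move=> [y|] z /= zy.
    have [w wE] : exists w, f w = z.
      by apply/f_init; apply: wo_lt_trans zy _; apply/f_init; exists y.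
    by exists (Some w).
  by have [w wE] := (f_init z).1 zy; exists (Some w).
Qed.

(** * The iteration along [omega2] *)

Section Omega2.

Let st : omega2 -> set degree := @stage _ Theta2 (down_deg deg0) omega2.

Let fin2P (P : 'I_2 -> Prop) : P ord0 -> P ord_max -> forall i, P i.
Proof.
move=> P0 P1 [[|[|//]] i2].
  by have -> : Ordinal i2 = ord0 by exact: val_inj.
by have -> : Ordinal i2 = ord_max by exact: val_inj.
Qed.

Lemma omega2_succ (n : nat) (i : 'I_2) :
  @wo_is_succ omega2 (n, i) (n.+1, i).
Proof.
split; first by right; split => //=.
move=> [m j] [/= ji|[/= ji mn]] [/= ij|[/= ij nm]]; last by lia.
- by have := ltn_trans ij ji; rewrite ltnn.
- by rewrite ij ltnn in ji.
- by rewrite ji ltnn in ij.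
Qed.

Lemma stage_omega2_succ (n : nat) (i : 'I_2) :
  st (n.+1, i) = Theta2 (st (n, i)).
Proof. exact: stage_succ (omega2_succ n i). Qed.

Lemma stage_omega2_low n : st (n, ord0) = down_deg (deg (zero_jump n)).
Proof.
elim: n => [|n IH]; last by rewrite stage_omega2_succ IH Theta2_zero_jump.
by apply: stage_zero => -[m j] [//|[]].
Qed.

Lemma stage_omega2_omega : st (0, ord_max) = A_omega.
Proof.
rewrite /st stage_limit.
  apply/seteqP; split=> d.
    move=> [[m j]]; elim/fin2P: j => -[/= //|[//= _]//] _; rewrite -/(st _).
    by rewrite stage_omega2_low; exists m.
  move=> [n _ dn]; exists (n, ord0); first by left.
  by rewrite -/(st _) stage_omega2_low.
split; first by move=> /(_ (0, ord0)); apply; left.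
(* A predecessor would be some [(m, ord0)], but [(m.+1, ord0)] lies strictly between. *)
move=> [m j]; elim/fin2P: j => -[[/= |[//= _]]//] _ /(_ (m.+1, ord0)).
by apply; [left|right].
Qed.

(** The index is shifted by one: the limit stage is [A_omega], and the degree of [zero_jump_omega]
    enters only one step later. *)
Lemma stage_omega2_high n :
  st (n.+1, ord_max) = down_deg (deg (zero_jump_omega_add n)).
Proof.
elim: n => [|n IH]; rewrite stage_omega2_succ.
  by rewrite stage_omega2_omega Theta2_A_omega.
by rewrite IH Theta2_zero_jump_omega_add.
Qed.

Lemma iterate_omega2 : iterate Theta2 (down_deg deg0) omega2 = A_omega2.
Proof.
rewrite /iterate stage_limit.
  apply/seteqP; split=> d.
    move=> [[[m j]|//] _]; rewrite stage_Some -/(st _).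
    elim/fin2P: j; first rewrite stage_omega2_low => dm.
      by apply: A_omega_sub_A_omega2; exists m.
    case: m => [|m].
      by rewrite stage_omega2_omega => /A_omega_sub_A_omega2.
    by rewrite stage_omega2_high; exists m.
  move=> [n _ dn]; exists (Some (n.+1, ord_max)) => //.
  by rewrite stage_Some -/(st _) stage_omega2_high.
split; first by move=> /(_ (Some (0, ord0))); apply.
(* The top has no predecessor, because [(m.+1, j)] lies strictly between [(m, j)] and it. *)
move=> [[m j]|] [//= _] /(_ (Some (m.+1, j)) Logic.I).
by apply; right.
Qed.

Lemma stage_omega2_not_fixed (x : omega2) : Theta2 (st x) <> st x.
Proof.
case: x => n; elim/fin2P.
  rewrite -stage_omega2_succ !stage_omega2_low => E.
  have : down_deg (deg (zero_jump n.+1)) (deg (zero_jump n.+1)).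
    exact: deg_le_refl.
  by rewrite E => /deg_leE; exact: jump_not_turing_le.
case: n => [|n].
  rewrite stage_omega2_omega Theta2_A_omega => E.
  have : A_omega (deg zero_jump_omega) by rewrite -E; exact: deg_le_refl.
  (* Otherwise some finite jump would bound [zero_jump_omega], and with it all of [A_omega]. *)
  move=> [n _ wn]; apply: (@jumps_ideal_unbounded set0 n) => a.
  by move=> /(@A_omega_sub_down 0) aw; exact: deg_le_trans aw wn.
rewrite -stage_omega2_succ !stage_omega2_high => E.
have : down_deg (deg (zero_jump_omega_add n.+1))
         (deg (zero_jump_omega_add n.+1)).
  exact: deg_le_refl.
by rewrite E => /deg_leE; exact: jump_not_turing_le.
Qed.

End Omega2.

(** The first clause ensures that [Theta2], defined on arbitrary sets of degrees, is an operator on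
    Turing ideals. *)
Theorem theorem5p1 :
  [/\ forall I : set degree, turing_ideal I -> turing_ideal (Theta2 I),
      closure_ordinal Theta2 (down_deg deg0) omega2
    & least_fixed_ideal Theta2 A_omega2].
Proof.
split; [exact: turing_ideal_Theta2| |exact: least_fixed_A_omega2].
split; first by rewrite iterate_omega2 Theta2_A_omega2.
by move=> b /iterate_initial-/(_ degree Theta2 (down_deg deg0))[x ->];
  exact: stage_omega2_not_fixed.
Qed.
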